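(* Let $m\ge 2$, let $\mathcal{S}_1,\mathcal{S}_2\subset\{1,\dots,m\}$ and $\mathbf{a},\mathbf{b}\in(\mathbb{C}^\times)^m$. Then $$M(\mathbf{a},\mathcal{S}_1)\simeq M(\mathbf{b},\mathcal{S}_2)\quad\Longleftrightarrow\quad \mathcal{S}_1=\mathcal{S}_2\ \text{ and there exists }\gamma\in\mathbb{C}^\times\text{ such that }\mathbf{a}=\gamma\,\mathbf{b}.$$
   Context: Everything is over $\mathbb{C}$. $\mathfrak{sl}(m|1)$ is the Lie superalgebra of supertraceless $(m+1)\times(m+1)$ matrices with rows and columns indexed by $\{1,\dots,m\}\cup\{\bar 1\}$; $e_{IJ}$ are the matrix units, with $e_{ij}$ even and $e_{i\bar 1},e_{\bar 1 i}$ odd, and $[x,y]=xy-(-1)^{|x||y|}yx$. Put $h_i=e_{ii}+e_{\bar 1\bar 1}$ for $1\le i\le m$; these span the Cartan subalgebra $\mathfrak{h}$, and $\mathcal{U}(\mathfrak{h})=\mathbb{C}[\mathbf{h}]=\mathbb{C}[h_1,\dots,h_m]$. For $1\le i\le m$, $\sigma_i$ is the $\mathbb{C}$-algebra automorphism of $\mathbb{C}[\mathbf{h}]$ with $\sigma_i(h_i)=h_i-1$ and $\sigma_i(h_j)=h_j$ for $j\ne i$; $\Delta=\sigma_1\cdots\sigma_m$ and $\Delta_i=\sigma_i^{-1}\Delta$. Automorphisms act entrywise on vectors and matrices. $\mathcal{U}(\mathfrak{sl}(m|1))$ is viewed as an ungraded associative algebra, so a module is a vector space on which $[x,y]$ acts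 as $xy-(-1)^{|x||y|}yx$ for homogeneous $x,y$; $\simeq$ means isomorphism of (ungraded) $\mathcal{U}(\mathfrak{sl}(m|1))$-modules. For $\mathbf{a}=(a_1,\dots,a_m)\in(\mathbb{C}^\times)^m$ and $\mathcal{S}\subset\{1,\dots,m\}$, $M(\mathbf{a},\mathcal{S})$ is the $\mathcal{U}(\mathfrak{sl}(m|1))$-module with underlying space $\mathbb{C}[\mathbf{h}]^{\oplus 2}$ (column vectors), $h_i$ acting by multiplication, $e_{i\bar 1}\cdot\mathbf{f}=E_{i\bar 1}\Delta_i^{-1}(\mathbf{f})$ and $e_{\bar 1 i}\cdot\mathbf{f}=E_{\bar 1 i}\Delta_i(\mathbf{f})$, where $E_{i\bar{1}} = \begin{bmatrix} 0 & a_i h_i \\ 0 & 0 \end{bmatrix}$, $E_{\bar{1}i} = \begin{bmatrix} 0 & 0 \\ a_i^{-1} & 0 \end{bmatrix}$ if $i \in \mathcal{S}$, and $E_{i\bar{1}} = \begin{bmatrix} 0 & a_i \\ 0 & 0 \end{bmatrix}$, $E_{\bar{1}i} = \begin{bmatrix} 0 & 0 \\ a_i^{-1} h_{i} & 0 \end{bmatrix}$ if $i \notin \mathcal{S}$. The remaining elements act as determined by these, since the $e_{i\bar 1},e_{\bar 1 i}$ generate $\mathfrak{sl}(m|1)$. *)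

(* Defs.v *)
From HB Require Import structures.
From mathcomp Require Import all_boot all_order all_algebra.
From mathcomp Require Import mpoly.

Set Implicit Arguments.
Unset Strict Implicit.
Unset Printing Implicit Defensive.

Import GRing.Theory.
Local Open Scope ring_scope.

(* The definitions make sense over any field F and are used for F = R[i].
   Rows and columns of 'M_(m + 1) are indexed by {1, ..., m} (through lshift)
   and \bar 1 (through rshift). *)

Section LieSuperalgebra.

Variables (F : fieldType) (m : nat).
Implicit Types (X Y : 'M[F]_(m + 1)) (p q : bool).

Definition supertrace X : F := \tr (ulsubmx X) - \tr (drsubmx X).

(* Parities are booleans: false is even, true is odd. *)
Definition homog_part p X : 'M[F]_(m + 1) :=
  if p then block_mx 0 (ursubmx X) (dlsubmx X) 0
  else block_mx (ulsubmx X) 0 0 (drsubmx X).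

Definition homogeneous p X : bool := homog_part p X == X.

Definition superbracket X Y : 'M[F]_(m + 1) :=
  \sum_(p : bool) \sum_(q : bool)
    (homog_part p X *m homog_part q Y
     - (-1) ^+ (p && q) *: (homog_part q Y *m homog_part p X)).

Lemma homog_part_id p q X :
  homogeneous p X -> homog_part q X = if p == q then X else 0.
Proof.
move/eqP=> <-; case: p; case: q; rewrite /homog_part /= ?block_mxKul
  ?block_mxKur ?block_mxKdl ?block_mxKdr //.
  by apply/eqP; rewrite block_mx_eq0 !eqxx.
by apply/eqP; rewrite block_mx_eq0 !eqxx.
Qed.

Lemma superbracket_homog p q X Y : homogeneous p X -> homogeneous q Y ->
  superbracket X Y = X *m Y - (-1) ^+ (p && q) *: (Y *m X).
Proof.
move=> hX hY; rewrite /superbracket !big_bool.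
rewrite !(homog_part_id _ hX) !(homog_part_id _ hY).
by case: p {hX}; case: q {hY}; rewrite /= ?(oppr0, mulmx0, mul0mx, scaler0, subr0, addr0, add0r).
Qed.

Lemma supertrace_is_linear : linear_for *%R supertrace.
Proof.
move=> c X Y; rewrite /supertrace !ulsubmxEsub !drsubmxEsub !linearP /= mulrBr opprD.
by rewrite addrACA.
Qed.
HB.instance Definition _ :=
  GRing.isLinear.Build F 'M[F]_(m + 1) F *%R supertrace supertrace_is_linear.

Lemma supertrace_block A B C D :
  supertrace (block_mx A B C D) = \tr A - \tr D.
Proof. by rewrite /supertrace block_mxKul block_mxKdr. Qed.

Lemma supertrace_bracket X Y : supertrace (superbracket X Y) = 0.
Proof.
rewrite /superbracket !big_bool /homog_part /= expr1 expr0 scaleN1r !scale1r opprK.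
rewrite !raddfD /= !mulmx_block !opp_block_mx !supertrace_block.
rewrite !(mulmx0, mul0mx, add0r, addr0, oppr0, mxtrace0, subr0).
rewrite [\tr (ursubmx X *m _)]mxtrace_mulC [\tr (ursubmx Y *m _)]mxtrace_mulC.
rewrite [\tr (ulsubmx X *m _)]mxtrace_mulC [\tr (drsubmx X *m _)]mxtrace_mulC.
by rewrite !raddfN /= -opprD subrr addr0 addrA subrK subrr.
Qed.

Definition supertraceless : {pred 'M[F]_(m + 1)} :=
  fun X => supertrace X == 0.

Lemma supertraceless_submod : submod_closed supertraceless.
Proof.
split=> [|c X Y]; rewrite !unfold_in ?linear0 // => /eqP hX /eqP hY.
by rewrite linearP /= hX hY mulr0 addr0.
Qed.
HB.instance Definition _ :=
  GRing.isSubmodClosed.Build F 'M[F]_(m + 1) supertraceless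
    supertraceless_submod.

(* The underlying space of sl(m|1). *)
Record sl := SL {
  sl_mx :> 'M[F]_(m + 1);
  sl_mxP : sl_mx \in supertraceless
}.
HB.instance Definition _ := [isSub for sl_mx].
HB.instance Definition _ := [Choice of sl by <:].
HB.instance Definition _ := [SubChoice_isSubLmodule of sl by <:].

Lemma sl_bracket_subproof (X Y : sl) : superbracket X Y \in supertraceless.
Proof. by rewrite unfold_in supertrace_bracket. Qed.
Definition sl_bracket (X Y : sl) : sl := SL (sl_bracket_subproof X Y).

Definition h_mx (i : 'I_m) : 'M[F]_(m + 1) :=
  delta_mx (lshift 1 i) (lshift 1 i) + delta_mx (rshift m 0) (rshift m 0).
Definition ib_mx (i : 'I_m) : 'M[F]_(m + 1) :=
  delta_mx (lshift 1 i) (rshift m 0).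
Definition bi_mx (i : 'I_m) : 'M[F]_(m + 1) :=
  delta_mx (rshift m 0) (lshift 1 i).

Lemma h_mx_block i : h_mx i = block_mx (delta_mx i i) 0 0 1%:M.
Proof.
rewrite /h_mx -[LHS]submxK; congr block_mx; apply/matrixP => j k;
  rewrite !mxE ?eq_lshift ?eq_rshift ?eq_lrshift ?eq_rlshift ?andbF ?addr0 //.
by rewrite [j]ord1 [k]ord1 add0r.
Qed.

Lemma ib_mx_block i : ib_mx i = block_mx 0 (delta_mx i 0) 0 0.
Proof.
rewrite /ib_mx -[LHS]submxK; congr block_mx; apply/matrixP => j k;
  by rewrite !mxE ?eq_lshift ?eq_rshift ?eq_lrshift ?eq_rlshift ?andbF.
Qed.

Lemma bi_mx_block i : bi_mx i = block_mx 0 0 (delta_mx 0 i) 0.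
Proof.
rewrite /bi_mx -[LHS]submxK; congr block_mx; apply/matrixP => j k;
  by rewrite !mxE ?eq_lshift ?eq_rshift ?eq_lrshift ?eq_rlshift ?andbF.
Qed.

Lemma h_mx_supertraceless i : h_mx i \in supertraceless.
Proof.
rewrite unfold_in h_mx_block supertrace_block mxtrace1 subr_eq0; apply/eqP.
rewrite /mxtrace (bigD1 i) //= mxE eqxx big1 ?addr0 // => j /negPf ji.
by rewrite mxE ji.
Qed.

Lemma ib_mx_supertraceless i : ib_mx i \in supertraceless.
Proof. by rewrite unfold_in ib_mx_block supertrace_block !mxtrace0 subrr. Qed.

Lemma bi_mx_supertraceless i : bi_mx i \in supertraceless.
Proof. by rewrite unfold_in bi_mx_block supertrace_block !mxtrace0 subrr. Qed.

Definition sl_h i : sl := SL (h_mx_supertraceless i).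
Definition sl_ib i : sl := SL (ib_mx_supertraceless i).
Definition sl_bi i : sl := SL (bi_mx_supertraceless i).

(* Modules over U(sl(m|1)), viewed as an ungraded associative algebra. *)
Record sl_module := SLModule {
  sl_carrier :> lmodType F;
  sl_act : sl -> sl_carrier -> sl_carrier;
  sl_act_linearl : forall v, linear (sl_act ^~ v);
  sl_act_linearr : forall X : sl, linear (sl_act X);
  sl_act_bracket : forall p q (X Y : sl) v,
    homogeneous p X -> homogeneous q Y ->
    sl_act (sl_bracket X Y) v
      = sl_act X (sl_act Y v) - (-1) ^+ (p && q) *: sl_act Y (sl_act X v)
}.

Definition sl_module_iso (V W : sl_module) : Prop :=
  exists f : {linear V -> W},
    bijective f /\ forall (X : sl) v, f (sl_act X v) = sl_act X (f v).

End LieSuperalgebra.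

(* Operators Q i, P i on V (the images of e_{i \bar 1}, e_{\bar 1 i}) satisfying
   the relations below extend to a representation of sl(m|1). *)
Section OddGenerators.

Variables (F : fieldType) (m : nat) (V : lmodType F).
Variables (Q P : 'I_m -> {linear V -> V}).

Definition odd_anticomm i j (v : V) : V := Q i (P j v) + P j (Q i v).

Definition odd_action (X : 'M[F]_(m + 1)) (v : V) : V :=
  \sum_i \sum_j ulsubmx X i j *: odd_anticomm i j v
  + \sum_i ursubmx X i 0 *: Q i v + \sum_i dlsubmx X 0 i *: P i v.

Hypothesis QQ : forall i j v, Q i (Q j v) = 0.
Hypothesis PP : forall i j v, P i (P j v) = 0.
Hypothesis QPQ : forall i j k v,
  Q i (P j (Q k v)) - Q k (P j (Q i v))
    = (j == k)%:R *: Q i v - (i == j)%:R *: Q k v.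
Hypothesis PQP : forall i j k v,
  P i (Q j (P k v)) - P k (Q j (P i v))
    = (i == j)%:R *: P k v - (j == k)%:R *: P i v.

Let T := odd_anticomm.
Let actT (A : 'M[F]_m) v := \sum_i \sum_j A i j *: T i j v.
Let actQ (B : 'cV[F]_m) v := \sum_i B i 0 *: Q i v.
Let actP (C : 'rV[F]_m) v := \sum_i C 0 i *: P i v.

Let odd_actionE A B C D v :
  odd_action (block_mx A B C D) v = actT A v + actQ B v + actP C v.
Proof. by rewrite /odd_action block_mxKul block_mxKur block_mxKdl. Qed.

Let TQ i j k v :
  T i j (Q k v) = Q k (T i j v) + (j == k)%:R *: Q i v - (i == j)%:R *: Q k v.
Proof.
rewrite /T /odd_anticomm linearD /= !QQ linear0 addr0 add0r.
by rewrite -addrA -QPQ addrC subrK.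
Qed.

Let TP i j k v :
  T i j (P k v) = P k (T i j v) + (i == j)%:R *: P k v - (i == k)%:R *: P j v.
Proof.
rewrite /T /odd_anticomm linearD /= !PP linear0 addr0 add0r.
by rewrite -addrA [i == j]eq_sym -PQP addrC subrK.
Qed.

Let sum_delta (G : 'I_m -> V) k (c : 'I_m -> F) :
  \sum_j c j *: ((j == k)%:R *: G j) = c k *: G k.
Proof.
rewrite (bigD1 k) //= eqxx scale1r big1 ?addr0 // => j /negPf ->.
by rewrite scale0r scaler0.
Qed.

Let T_is_linear i j : linear (T i j).
Proof.
move=> c u v; rewrite /T /odd_anticomm !linearP /= scalerDr !addrA.
by congr (_ + _); rewrite -!addrA; congr (_ + _); rewrite addrC.
Qed.

Let actT_is_linear A : linear (actT A).
Proof.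
move=> c u v; rewrite /actT scaler_sumr -big_split; apply: eq_bigr => i _ /=.
rewrite scaler_sumr -big_split; apply: eq_bigr => j _ /=.
by rewrite T_is_linear scalerDr !scalerA mulrC.
Qed.

Let actT_linl A A' v : actT (A - A') v = actT A v - actT A' v.
Proof.
rewrite /actT -sumrB; apply: eq_bigr => i _; rewrite -sumrB.
by apply: eq_bigr => j _; rewrite !mxE scalerBl.
Qed.

Let actT_linl' A A' v : actT (A + A') v = actT A v + actT A' v.
Proof.
rewrite /actT -big_split; apply: eq_bigr => i _; rewrite -big_split.
by apply: eq_bigr => j _; rewrite !mxE scalerDl.
Qed.

Let actQ_linl B B' v : actQ (B - B') v = actQ B v - actQ B' v.
Proof.
by rewrite /actQ -sumrB; apply: eq_bigr => i _; rewrite !mxE scalerBl.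
Qed.

Let actP_linl C C' v : actP (C - C') v = actP C v - actP C' v.
Proof.
by rewrite /actP -sumrB; apply: eq_bigr => i _; rewrite !mxE scalerBl.
Qed.

Let actT0 v : actT 0 v = 0.
Proof. by rewrite -[X in actT X](subrr 0) actT_linl subrr. Qed.
Let actQ0 v : actQ 0 v = 0.
Proof. by rewrite -[X in actQ X](subrr 0) actQ_linl subrr. Qed.
Let actP0 v : actP 0 v = 0.
Proof. by rewrite -[X in actP X](subrr 0) actP_linl subrr. Qed.

Lemma odd_action_linearl v : linear (odd_action ^~ v).
Proof.
move=> c X Y; rewrite /odd_action !scalerDr [RHS](AC (3*3) ((1*4)*(2*5)*(3*6))) /=.
congr (_ + _ + _); rewrite scaler_sumr -big_split; apply: eq_bigr => i _ /=.
- rewrite scaler_sumr -big_split; apply: eq_bigr => j _ /=.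
  by rewrite !mxE scalerDl scalerA.
- by rewrite !mxE scalerDl scalerA.
- by rewrite !mxE scalerDl scalerA.
Qed.

Let actQ_is_linear B : linear (actQ B).
Proof.
move=> c u v; rewrite /actQ scaler_sumr -big_split; apply: eq_bigr => i _ /=.
by rewrite linearP scalerDr !scalerA mulrC.
Qed.

Let actP_is_linear C : linear (actP C).
Proof.
move=> c u v; rewrite /actP scaler_sumr -big_split; apply: eq_bigr => i _ /=.
by rewrite linearP scalerDr !scalerA mulrC.
Qed.

Lemma odd_action_linearr X : linear (odd_action X).
Proof.
move=> c u v; rewrite -[X]submxK !odd_actionE.
rewrite actT_is_linear actQ_is_linear actP_is_linear !scalerDr.
by rewrite [LHS](AC (2*2*2) ((1*3*5)*(2*4*6))).
Qed.

HB.instance Definition _ A := GRing.isLinear.Build F V V _ _ (actT_is_linear A).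
HB.instance Definition _ B := GRing.isLinear.Build F V V _ _ (actQ_is_linear B).
HB.instance Definition _ C := GRing.isLinear.Build F V V _ _ (actP_is_linear C).

Let actTQ A k v :
  actT A (Q k v) = Q k (actT A v) + \sum_i A i k *: Q i v - \tr A *: Q k v.
Proof.
rewrite /actT linear_sum /mxtrace scaler_suml -big_split -sumrB.
apply: eq_bigr => i _ /=; rewrite linear_sum /=.
under eq_bigr do rewrite TQ scalerBr scalerDr.
rewrite sumrB big_split /= sum_delta; congr (_ + _ - _).
  by apply: eq_bigr => j _; rewrite linearZ.
under eq_bigr do rewrite eq_sym.
exact: (sum_delta (fun=> Q k v)).
Qed.

Let actTP A k v :
  actT A (P k v) = P k (actT A v) + \tr A *: P k v - \sum_j A k j *: P j v.
Proof.
rewrite /actT linear_sum /mxtrace scaler_suml -big_split /=.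
under eq_bigr => i _.
  under eq_bigr do rewrite TP scalerBr scalerDr.
  rewrite sumrB big_split /=.
  under [X in _ + X - _]eq_bigr do rewrite eq_sym.
  rewrite (sum_delta (fun=> P k v)).
over.
rewrite sumrB /=; congr (_ - _).
  apply: eq_bigr => i _; rewrite linear_sum; congr (_ + _).
  by apply: eq_bigr => j _; rewrite linearZ.
rewrite exchange_big; apply: eq_bigr => j _ /=.
exact: (sum_delta (fun=> P j v) k (fun i => A i j)).
Qed.

Let actTT A k l v :
  actT A (T k l v) = T k l (actT A v)
    + \sum_i A i k *: T i l v - \sum_j A l j *: T k j v.
Proof.
have abel (x y t u s1 s2 s3 s4 : V) :
  (x + t - s2 + s1 - t) + (y + s3 - u + u - s4) = x + y + (s1 + s3) - (s2 + s4).
  rewrite subrK [x + t - s2 + s1 - t](AC 5 ((2*5)*1*3*4)) /= subrr add0r opprD.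
  by rewrite [LHS](AC (3*3) ((1*4)*(3*5)*(2*6))).
rewrite [T k l v]/T /odd_anticomm linearD /= actTQ actTP actTP actTQ.
rewrite !(linearB, linearD) /= [Q k (_ *: _)]linearZ [P l (_ *: _)]linearZ /=.
rewrite [Q k (\sum_(j < m) A l j *: P j v)]linear_sum.
rewrite [P l (\sum_(i < m) A i k *: Q i v)]linear_sum /=.
rewrite abel; congr (_ + _ - _).
  rewrite -big_split; apply: eq_bigr => i _ /=.
  by rewrite linearZ -scalerDr.
rewrite -big_split; apply: eq_bigr => i _ /=.
by rewrite linearZ -scalerDr.
Qed.

Let actTactT A A' v :
  actT A (actT A' v) - actT A' (actT A v) = actT (A *m A' - A' *m A) v.
Proof.
have -> : actT A (actT A' v) = actT A' (actT A v)
    + actT (A *m A') v - actT (A' *m A) v; last first.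
  by rewrite actT_linl addrAC [X in X - _]addrAC subrr add0r.
rewrite {2}/actT linear_sum /=.
under eq_bigr => k _.
  rewrite linear_sum /=.
  under eq_bigr do rewrite linearZ /= actTT scalerBr scalerDr.
  rewrite sumrB big_split /=.
over.
rewrite sumrB big_split /=; congr (_ + _ - _).
- rewrite exchange_big [RHS]exchange_big; apply: eq_bigr => l _ /=.
  under eq_bigr do rewrite scaler_sumr.
  rewrite exchange_big; apply: eq_bigr => i _ /=.
  rewrite mxE scaler_suml; apply: eq_bigr => k _ /=.
  by rewrite scalerA mulrC.
- apply: eq_bigr => k _ /=.
  under eq_bigr do rewrite scaler_sumr.
  rewrite exchange_big; apply: eq_bigr => j _ /=.
  rewrite mxE scaler_suml; apply: eq_bigr => l _ /=.
  by rewrite scalerA.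
Qed.

Let actTactQ A B v :
  actT A (actQ B v) - actQ B (actT A v) = actQ (A *m B - B *m (\tr A)%:M) v.
Proof.
rewrite actQ_linl mul_mx_scalar.
have -> : actT A (actQ B v) = actQ B (actT A v)
    + actQ (A *m B) v - actQ (\tr A *: B) v; last first.
  by rewrite addrAC [X in X - _]addrAC subrr add0r.
rewrite {2}/actQ linear_sum /=.
under eq_bigr do rewrite linearZ /= actTQ scalerBr scalerDr.
rewrite sumrB big_split /=; congr (_ + _ - _).
- under eq_bigr do rewrite scaler_sumr.
  rewrite exchange_big; apply: eq_bigr => i _ /=.
  rewrite mxE scaler_suml; apply: eq_bigr => k _ /=.
  by rewrite scalerA mulrC.
- by apply: eq_bigr => i _; rewrite mxE scalerA mulrC.
Qed.

Let actTactP A C v :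
  actT A (actP C v) - actP C (actT A v) = actP ((\tr A)%:M *m C - C *m A) v.
Proof.
rewrite actP_linl mul_scalar_mx.
have -> : actT A (actP C v) = actP C (actT A v)
    + actP (\tr A *: C) v - actP (C *m A) v; last first.
  by rewrite addrAC [X in X - _]addrAC subrr add0r.
rewrite {2}/actP linear_sum /=.
under eq_bigr do rewrite linearZ /= actTP scalerBr scalerDr.
rewrite sumrB big_split /=; congr (_ + _ - _).
- by apply: eq_bigr => i _; rewrite mxE scalerA mulrC.
- under eq_bigr do rewrite scaler_sumr.
  rewrite exchange_big; apply: eq_bigr => i _ /=.
  rewrite mxE scaler_suml; apply: eq_bigr => k _ /=.
  by rewrite scalerA.
Qed.

Let actQactP B C v :
  actQ B (actP C v) + actP C (actQ B v) = actT (B *m C) v.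
Proof.
transitivity (\sum_i \sum_j
   (B i 0 * C 0 j *: Q i (P j v) + B i 0 * C 0 j *: P j (Q i v))).
  under [RHS]eq_bigr do rewrite big_split.
  rewrite big_split /=; congr (_ + _).
    apply: eq_bigr => i _; rewrite /actP linear_sum scaler_sumr /=.
    by apply: eq_bigr => j _; rewrite linearZ scalerA.
  rewrite exchange_big; apply: eq_bigr => i _ /=.
  rewrite /actQ linear_sum scaler_sumr /=.
  by apply: eq_bigr => j _; rewrite linearZ scalerA mulrC.
apply: eq_bigr => i _; apply: eq_bigr => j _.
by rewrite -scalerDr mxE big_ord1.
Qed.

Let actQactQ B B' v : actQ B (actQ B' v) = 0.
Proof.
rewrite {1}/actQ big1 // => i _; rewrite /actQ linear_sum big1 ?scaler0 //= => j _.
by rewrite linearZ /= QQ scaler0.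
Qed.

Let actPactP C C' v : actP C (actP C' v) = 0.
Proof.
rewrite {1}/actP big1 // => i _; rewrite /actP linear_sum big1 ?scaler0 //= => j _.
by rewrite linearZ /= PP scaler0.
Qed.

Let actQN B v : actQ (- B) v = - actQ B v.
Proof. by rewrite -[- B]add0r actQ_linl actQ0 add0r. Qed.
Let actPN C v : actP (- C) v = - actP C v.
Proof. by rewrite -[- C]add0r actP_linl actP0 add0r. Qed.

Lemma odd_action_bracket p q (X Y : sl F m) v :
  homogeneous p X -> homogeneous q Y ->
  odd_action (sl_bracket X Y) v = odd_action X (odd_action Y v)
    - (-1) ^+ (p && q) *: odd_action Y (odd_action X v).
Proof.
move=> hX hY; rewrite /= (superbracket_homog hX hY).
have dr (Z : sl F m) : drsubmx (sl_mx Z) = (\tr (ulsubmx (sl_mx Z)))%:M.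
  have := sl_mxP Z; rewrite unfold_in /supertrace subr_eq0 => /eqP ->.
  by rewrite trace_mx11 -mx11_scalar.
move: (dr X) (dr Y); move: hX hY; rewrite /homogeneous /homog_part.
move: (sl_mx X) (sl_mx Y) => {X Y dr} X Y.
set A := ulsubmx X; set A' := ulsubmx Y.
move=> /eqP hX /eqP hY drX drY; rewrite -{}hX -{}hY drX drY.
case: p; case: q; rewrite ?expr1 ?expr0 ?scaleN1r ?scale1r ?opprK !mulmx_block;
  rewrite ?opp_block_mx add_block_mx !odd_actionE;
  rewrite !(mulmx0, mul0mx, add0r, addr0, oppr0, actT0, actQ0, actP0).
- rewrite !linearD /= !actQactQ !actPactP !add0r !addr0 actT_linl' -!actQactP.
  by rewrite [RHS](AC (2*2) ((1*4)*(3*2))).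
- rewrite linearD /= -[X in actQ X]opprB -[X in actP X]opprB.
  rewrite actQN actPN -actTactQ -actTactP !opprB opprD.
  by rewrite [RHS](AC (2*2) ((1*3)*(2*4))).
- rewrite linearD /= -actTactQ -actTactP opprD.
  by rewrite [RHS](AC (2*2) ((1*3)*(2*4))).
- by rewrite actTactT.
Qed.

End OddGenerators.

Section ExponentialModules.

Variables (F : fieldType) (m : nat).
Local Notation poly_h := {mpoly F[m]}.

Definition sigma (i : 'I_m) (p : poly_h) : poly_h :=
  p \mPo [tuple 'X_j - (j == i)%:R | j < m].

Definition sigma_inv (i : 'I_m) (p : poly_h) : poly_h :=
  p \mPo [tuple 'X_j + (j == i)%:R | j < m].

Definition Delta : poly_h -> poly_h :=
  \big[(fun g h : poly_h -> poly_h => g \o h)/id]_(i < m) sigma i.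

(* The sigma i commute, so the order of composition is immaterial. *)
Definition Delta_inv : poly_h -> poly_h :=
  \big[(fun g h : poly_h -> poly_h => g \o h)/id]_(i < m) sigma_inv i.

Definition Delta_ (i : 'I_m) : poly_h -> poly_h := sigma_inv i \o Delta.

Definition Delta_inv_ (i : 'I_m) : poly_h -> poly_h := Delta_inv \o sigma i.

Definition shift (c : 'I_m -> F) (p : poly_h) : poly_h :=
  p \mPo [tuple 'X_j + (c j)%:MP | j < m].

HB.instance Definition _ c := GRing.LRMorphism.copy (shift c)
  (comp_mpoly [tuple 'X_j + (c j)%:MP | j < m]).

Lemma eq_shift c d p : c =1 d -> shift c p = shift d p.
Proof. by move=> e; congr (_ \mPo _); apply: eq_mktuple => j; rewrite e. Qed.

Lemma shiftX c i : shift c 'X_i = 'X_i + (c i)%:MP.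
Proof. by rewrite /shift comp_mpolyXU -tnth_nth tnth_mktuple. Qed.

Lemma shiftC c x : shift c x%:MP = x%:MP.
Proof. exact: comp_mpolyC. Qed.

Lemma shift_comp c d p : shift c (shift d p) = shift (fun j => c j + d j) p.
Proof.
rewrite [p]mpolyE (linear_sum (shift d)) (linear_sum (shift c)).
rewrite (linear_sum (shift _)) /=; apply: eq_bigr => u _.
rewrite !linearZ /= mpolyXE_id !rmorph_prod; congr (_ *: _).
apply: eq_bigr => j _; rewrite !rmorphXn /= !shiftX rmorphD /= shiftX shiftC.
by rewrite mpolyCD addrA.
Qed.

Lemma shift0 c p : (forall j, c j = 0) -> shift c p = p.
Proof.
move=> c0; rewrite -[RHS]comp_mpoly_id; congr (_ \mPo _).
by apply: eq_mktuple => j; rewrite c0 mpolyC0 addr0.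
Qed.

Lemma sigmaE i p : sigma i p = shift (fun j => - (j == i)%:R) p.
Proof.
congr (_ \mPo _); apply: eq_mktuple => j.
by rewrite mpolyCN rmorph_nat.
Qed.

Lemma sigma_invE i p : sigma_inv i p = shift (fun j => (j == i)%:R) p.
Proof.
by congr (_ \mPo _); apply: eq_mktuple => j; rewrite rmorph_nat.
Qed.

Lemma big_comp_shift (r : seq 'I_m) (g : 'I_m -> poly_h -> poly_h) c p :
    (forall i q, g i q = shift (c i) q) ->
  (\big[(fun g h : poly_h -> poly_h => g \o h)/id]_(i <- r) g i) p
    = shift (fun j => \sum_(i <- r) c i j) p.
Proof.
move=> gE; elim: r => [|i r IHr].
  by rewrite big_nil shift0 // => j; rewrite big_nil.
rewrite big_cons /= IHr gE shift_comp; apply: eq_shift => j.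
by rewrite big_cons.
Qed.

Lemma DeltaE p : Delta p = shift (fun=> -1) p.
Proof.
rewrite /Delta (big_comp_shift _ _ sigmaE); apply: eq_shift => j.
rewrite (bigD1 j) //= eqxx big1 ?addr0 // => i /negPf.
by rewrite eq_sym => ->; rewrite oppr0.
Qed.

Lemma Delta_invE p : Delta_inv p = shift (fun=> 1) p.
Proof.
rewrite /Delta_inv (big_comp_shift _ _ sigma_invE); apply: eq_shift => j.
rewrite (bigD1 j) //= eqxx big1 ?addr0 // => i /negPf.
by rewrite eq_sym => ->.
Qed.

Lemma Delta_E i p : Delta_ i p = shift (fun j => (j == i)%:R - 1) p.
Proof. by rewrite /Delta_ /= sigma_invE DeltaE shift_comp. Qed.

Lemma Delta_inv_E i p : Delta_inv_ i p = shift (fun j => 1 - (j == i)%:R) p.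
Proof. by rewrite /Delta_inv_ /= sigmaE Delta_invE shift_comp. Qed.

Lemma sigmaK i : cancel (sigma i) (sigma_inv i).
Proof.
by move=> p; rewrite sigmaE sigma_invE shift_comp shift0 // => j; rewrite subrr.
Qed.

Lemma sigma_invK i : cancel (sigma_inv i) (sigma i).
Proof.
by move=> p; rewrite sigmaE sigma_invE shift_comp shift0 // => j; rewrite addNr.
Qed.

Lemma Delta_K i : cancel (Delta_ i) (Delta_inv_ i).
Proof.
move=> p; rewrite Delta_E Delta_inv_E shift_comp shift0 // => j.
by rewrite addrA subrK subrr.
Qed.

Lemma Delta_inv_K i : cancel (Delta_inv_ i) (Delta_ i).
Proof.
move=> p; rewrite Delta_E Delta_inv_E shift_comp shift0 // => j.
by rewrite addrA subrK subrr.
Qed.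

(* C[h]^2 as a vector space over the ground field; the library only provides
   its structure of module over C[h]. *)
Definition hcol : Type := 'cV[poly_h]_2.
HB.instance Definition _ := GRing.Zmodule.on hcol.

Definition hcol_scale (c : F) (f : hcol) : hcol := map_mx ( *:%R c) f.

Lemma hcol_scaleA c d f : hcol_scale c (hcol_scale d f) = hcol_scale (c * d) f.
Proof. by apply/matrixP => i j; rewrite !mxE scalerA. Qed.
Lemma hcol_scale1 : left_id 1 hcol_scale.
Proof. by move=> f; apply/matrixP => i j; rewrite !mxE scale1r. Qed.
Lemma hcol_scaleDr : right_distributive hcol_scale +%R.
Proof. by move=> c f g; apply/matrixP => i j; rewrite !mxE scalerDr. Qed.
Lemma hcol_scaleDl f : {morph hcol_scale^~ f : c d / c + d}.
Proof. by move=> c d; apply/matrixP => i j; rewrite !mxE scalerDl. Qed.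
HB.instance Definition _ := GRing.Zmodule_isLmodule.Build F hcol
  hcol_scaleA hcol_scale1 hcol_scaleDr hcol_scaleDl.

Lemma hcol_linE c (f g : hcol) i j : (c *: f + g) i j = c *: (f i j) + g i j.
Proof. by rewrite !mxE. Qed.

Lemma hcol_addE (f g : hcol) i j : (f + g) i j = f i j + g i j.
Proof. by rewrite mxE. Qed.
Lemma hcol_subE (f g : hcol) i j : (f - g) i j = f i j - g i j.
Proof. by rewrite !mxE. Qed.
Lemma hcol_oppE (f : hcol) i j : (- f) i j = - f i j.
Proof. by rewrite mxE. Qed.
Lemma hcol_0E i j : (0 : hcol) i j = 0.
Proof. by rewrite mxE. Qed.

(* The relations between the odd operators, proved for opaque operators to keep
   unification from unfolding matrices and polynomials. *)
Section OddRelations.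

Variables (sh : ('I_m -> F) -> {lrmorphism poly_h -> poly_h}).
Variables (ib bi : 'I_m -> hcol -> hcol) (al be : 'I_m -> poly_h).
Let s (i j : 'I_m) : F := 1 - (j == i)%:R.
Hypothesis eq_sh : forall c d p, c =1 d -> sh c p = sh d p.
Hypothesis shX : forall c i, sh c 'X_i = 'X_i + (c i)%:MP.
Hypothesis sh_comp :
  forall c d p, sh c (sh d p) = sh (fun j => c j + d j) p.
Hypothesis sh0 : forall c p, (forall j, c j = 0) -> sh c p = p.
Hypothesis ib0 : forall i f, ib i f 0 0 = al i * sh (s i) (f 1 0).
Hypothesis ib1 : forall i f, ib i f 1 0 = 0.
Hypothesis bi0 : forall i f, bi i f 0 0 = 0.
Hypothesis bi1 : forall i f,
  bi i f 1 0 = be i * sh (fun j => - s i j) (f 0 0).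
Hypothesis al_loc : forall c d i, c i = d i -> sh c (al i) = sh d (al i).
Hypothesis be_loc : forall c d i, c i = d i -> sh c (be i) = sh d (be i).
Hypothesis al_be : forall i, al i * be i = 'X_i.

Let hcol_eq (f g : hcol) : f 0 0 = g 0 0 -> f 1 0 = g 1 0 -> f = g.
Proof.
move=> e0 e1; apply/matrixP => i j; rewrite [j]ord1.
case: i => [[|[|//]] Hi].
  by rewrite (_ : Ordinal Hi = 0) //; apply: val_inj.
by rewrite (_ : Ordinal Hi = 1) //; apply: val_inj.
Qed.

Lemma odd_ib_is_linear i : linear (ib i).
Proof.
move=> c f g; apply: hcol_eq; last first.
  by rewrite hcol_linE !ib1 scaler0 addr0.
rewrite hcol_linE !ib0 hcol_linE (linearP (sh _)) /=.
by rewrite mulrDr scalerAr.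
Qed.

Lemma odd_bi_is_linear i : linear (bi i).
Proof.
move=> c f g; apply: hcol_eq.
  by rewrite hcol_linE !bi0 scaler0 addr0.
rewrite hcol_linE !bi1 hcol_linE (linearP (sh _)) /=.
by rewrite mulrDr scalerAr.
Qed.

Let al0 c i : c i = 0 -> sh c (al i) = al i.
Proof. by move=> e; rewrite (@al_loc c (fun=> 0)) ?sh0. Qed.

Let be0 c i : c i = 0 -> sh c (be i) = be i.
Proof. by move=> e; rewrite (@be_loc c (fun=> 0)) ?sh0. Qed.

Lemma odd_ib_ib i j f : ib i (ib j f) = 0.
Proof.
by apply: hcol_eq; rewrite ?ib0 ib1 ?(linear0 (sh _)) ?mulr0 mxE.
Qed.

Lemma odd_bi_bi i j f : bi i (bi j f) = 0.
Proof.
by apply: hcol_eq; rewrite ?bi1 bi0 ?(linear0 (sh _)) ?mulr0 mxE.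
Qed.

Lemma odd_anticommE i f :
  ib i (bi i f) + bi i (ib i f) = ('X_i : poly_h) *: (f : 'cV_2).
Proof.
have si : s i i = 0 by rewrite /s eqxx subrr.
apply: hcol_eq; rewrite hcol_addE [RHS]mxE.
  rewrite ib0 bi1 bi0 addr0 (rmorphM (sh _)) /= be0 //.
  by rewrite mulrA al_be sh_comp sh0 // => j; exact: subrr.
rewrite ib1 bi1 ib0 add0r (rmorphM (sh _)) /= al0 ?si ?oppr0 //.
by rewrite mulrA [be i * _]mulrC al_be sh_comp sh0 // => j; exact: addNr.
Qed.

Let s_eq i j : s i j = (i != j)%:R.
Proof. by rewrite /s eq_sym; case: (i == j); rewrite ?subrr ?subr0. Qed.

Let ib_bi_ib i j k f :
  ib i (bi j (ib k f)) 0 0 =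
  al i * sh (s i) (be j) * sh (fun l => s i l - s j l) (al k)
    * sh (fun l => s i l - s j l + s k l) (f 1 0).
Proof. by rewrite ib0 bi1 ib0 !(rmorphM (sh _)) /= !sh_comp !mulrA. Qed.

Let bi_ib_bi i j k f :
  bi i (ib j (bi k f)) 1 0 =
  be i * sh (fun l => - s i l) (al j)
    * sh (fun l => - s i l + s j l) (be k)
    * sh (fun l => - s i l + s j l - s k l) (f 0 0).
Proof. by rewrite bi1 ib0 bi1 !(rmorphM (sh _)) /= !sh_comp !mulrA. Qed.

Let s1 i j : i != j -> s i j = 1.
Proof. by move=> ij; rewrite s_eq ij. Qed.
Let s0 i : s i i = 0.
Proof. by rewrite s_eq eqxx. Qed.

Let ib_bi_ib_eq i k f : i != k ->
  ib i (bi k (ib k f)) - ib k (bi k (ib i f))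
    = ib i f.
Proof.
move=> ik; apply: hcol_eq; rewrite hcol_subE; last first.
  by rewrite !ib1 subrr.
rewrite !ib_bi_ib ib0.
rewrite (@al_loc (fun l => s i l - s k l) (s i)); last by rewrite s0 subr0.
rewrite (@be0 (s k)) // (@al0 (fun l => s k l - s k l)) ?subrr //.
rewrite (@eq_sh (fun l => s i l - s k l + s k l) (s i)); last first.
  by move=> l; rewrite subrK.
rewrite (@eq_sh (fun l => s k l - s k l + s i l) (s i)); last first.
  by move=> l; rewrite subrr add0r.
rewrite -[al i * _ * _]mulrA -(rmorphM (sh _)) [be k * _]mulrC !al_be.
rewrite /= shX s1 // -mulrBl ['X_k * al i]mulrC -mulrBr addrC addrA addNr add0r.
by rewrite mulr1.
Qed.

Let bi_ib_bi_eq i k f : i != k ->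
  bi i (ib k (bi k f)) - bi k (ib k (bi i f))
    = - bi i f.
Proof.
move=> ik; apply: hcol_eq; rewrite hcol_subE hcol_oppE.
  by rewrite !bi0 subrr oppr0.
rewrite !bi_ib_bi bi1.
rewrite (@be_loc (fun l => - s i l + s k l) (fun l => - s i l)); last first.
  by rewrite s0 addr0.
rewrite (@al0 (fun l => - s k l)) ?s0 ?oppr0 //.
rewrite (@be0 (fun l => - s k l + s k l)) ?addNr //.
rewrite (@eq_sh (fun l => - s i l + s k l - s k l) (fun l => - s i l));
  last by move=> l; rewrite addrK.
rewrite (@eq_sh (fun l => - s k l + s k l - s i l) (fun l => - s i l));
  last by move=> l; rewrite addNr add0r.
rewrite -[be i * _ * _]mulrA -(rmorphM (sh _)) [be k * _]mulrC !al_be.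
rewrite /= shX s1 // -mulrBl ['X_k * be i]mulrC -mulrBr addrC addrA addNr add0r.
by rewrite mpolyCN mulrN1 mulNr.
Qed.

Lemma odd_ib_bi_ib i j k f :
  ib i (bi j (ib k f)) - ib k (bi j (ib i f))
    = (j == k)%:R *: ib i f - (i == j)%:R *: ib k f.
Proof.
have [<-|ik] := eqVneq i k; first by rewrite [j == i]eq_sym !subrr.
have [->|jk] := eqVneq j k.
  by rewrite (negPf ik) scale1r scale0r subr0 ib_bi_ib_eq.
have [<-|ij] := eqVneq i j.
  by rewrite scale1r scale0r sub0r -opprB ib_bi_ib_eq // eq_sym.
rewrite !scale0r subrr; apply: hcol_eq; rewrite hcol_subE.
  rewrite !ib_bi_ib hcol_0E.
  rewrite (@be_loc (s i) (s k)) ?s1 // 1?[k == j]eq_sym //.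
  rewrite !al0 ?s1 ?subrr // 1?[k == i]eq_sym // 1?[j == i]eq_sym //.
  rewrite [al i * _ * _]mulrAC [al i * al k]mulrC [al k * _ * _]mulrAC.
  apply/eqP; rewrite subr_eq0; apply/eqP; congr (_ * _).
  by apply: eq_sh => l; rewrite addrAC [RHS]addrAC [s i l + _]addrC.
by rewrite !ib1 hcol_0E subrr.
Qed.

Lemma odd_bi_ib_bi i j k f :
  bi i (ib j (bi k f)) - bi k (ib j (bi i f))
    = (i == j)%:R *: bi k f - (j == k)%:R *: bi i f.
Proof.
have [<-|ik] := eqVneq i k; first by rewrite [j == i]eq_sym !subrr.
have [->|jk] := eqVneq j k.
  by rewrite (negPf ik) scale1r scale0r sub0r bi_ib_bi_eq.
have [<-|ij] := eqVneq i j.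
  by rewrite scale1r scale0r subr0 -opprB bi_ib_bi_eq ?opprK // eq_sym.
rewrite !scale0r subrr; apply: hcol_eq; rewrite hcol_subE.
  by rewrite !bi0 hcol_0E subrr.
rewrite !bi_ib_bi hcol_0E.
rewrite (@al_loc (fun l => - s i l) (fun l => - s k l)); last first.
  by rewrite !s1 // eq_sym.
rewrite !be0 ?s1 ?addNr // 1?[k == i]eq_sym // 1?[j == i]eq_sym //.
rewrite [be i * _ * _]mulrAC [be i * be k]mulrC [be k * _ * _]mulrAC.
apply/eqP; rewrite subr_eq0; apply/eqP; congr (_ * _).
apply: eq_sh => l; rewrite addrAC [RHS]addrAC; congr (_ + _).
by rewrite addrC.
Qed.

End OddRelations.

Variables (a : 'rV[F]_m) (S : {set 'I_m}).

(* E_{i \bar 1} and E_{\bar 1 i}; \bar 1 is written b. *)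
Definition E_ib i : 'M[poly_h]_2 :=
  (if i \in S then a 0 i *: 'X_i else (a 0 i)%:MP) *: delta_mx 0 1.

Definition E_bi i : 'M[poly_h]_2 :=
  (if i \in S then ((a 0 i)^-1)%:MP else (a 0 i)^-1 *: 'X_i) *: delta_mx 1 0.

Definition act_h i (f : hcol) : hcol := ('X_i : poly_h) *: (f : 'cV_2).

Definition act_ib i (f : hcol) : hcol := E_ib i *m map_mx (Delta_inv_ i) f.

Definition act_bi i (f : hcol) : hcol := E_bi i *m map_mx (Delta_ i) f.

(* For i != j, e_{ij} = [e_{i \bar 1}, e_{\bar 1 j}]. A supertraceless X is the
   sum of the X_{ii} h_i, the X_{ij} e_{ij} with i != j and its odd part. *)
Definition act_e i j (f : hcol) : hcol :=
  act_ib i (act_bi j f) + act_bi j (act_ib i f).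

Definition M_act (X : sl F m) (f : hcol) : hcol :=
  \sum_i ulsubmx X i i *: act_h i f
  + \sum_i \sum_(j | j != i) ulsubmx X i j *: act_e i j f
  + \sum_i ursubmx X i 0 *: act_ib i f
  + \sum_i dlsubmx X 0 i *: act_bi i f.

Let al i : poly_h := if i \in S then a 0 i *: 'X_i else (a 0 i)%:MP.
Let be i : poly_h := if i \in S then ((a 0 i)^-1)%:MP else (a 0 i)^-1 *: 'X_i.
Let s (i j : 'I_m) : F := 1 - (j == i)%:R.

Let ib0 i f : act_ib i f 0 0 = al i * shift (s i) (f 1 0).
Proof.
rewrite /act_ib /E_ib -/(al i) -scalemxAl mxE mxE big_ord_recl big_ord1.
rewrite !mxE /= mul0r add0r mul1r Delta_inv_E.
by congr (_ * shift _ (f _ _)); apply: val_inj.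
Qed.

Let ib1 i f : act_ib i f 1 0 = 0.
Proof.
rewrite /act_ib /E_ib -/(al i) -scalemxAl mxE mxE big_ord_recl big_ord1.
by rewrite !mxE /= !mul0r add0r mulr0.
Qed.

Let bi0 i f : act_bi i f 0 0 = 0.
Proof.
rewrite /act_bi /E_bi -/(be i) -scalemxAl mxE mxE big_ord_recl big_ord1.
by rewrite !mxE /= !mul0r add0r mulr0.
Qed.

Let bi1 i f : act_bi i f 1 0 = be i * shift (fun j => - s i j) (f 0 0).
Proof.
rewrite /act_bi /E_bi -/(be i) -scalemxAl mxE mxE big_ord_recl big_ord1.
rewrite !mxE /= mul0r addr0 mul1r Delta_E.
by congr (_ * _); apply: eq_shift => j; rewrite /s opprB.
Qed.

Lemma act_ib_is_linear i : linear (act_ib i).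
Proof. exact: (@odd_ib_is_linear shift _ _ ib0 ib1). Qed.
HB.instance Definition _ i :=
  GRing.isLinear.Build F hcol hcol _ (act_ib i) (act_ib_is_linear i).

Lemma act_bi_is_linear i : linear (act_bi i).
Proof. exact: (@odd_bi_is_linear shift _ _ bi0 bi1). Qed.
HB.instance Definition _ i :=
  GRing.isLinear.Build F hcol hcol _ (act_bi i) (act_bi_is_linear i).

Let al_loc c d i : c i = d i -> shift c (al i) = shift d (al i).
Proof.
move=> e; rewrite /al; case: ifP => _; last by rewrite !shiftC.
by rewrite !linearZ /= !shiftX e.
Qed.

Let be_loc c d i : c i = d i -> shift c (be i) = shift d (be i).
Proof.
move=> e; rewrite /be; case: ifP => _; first by rewrite !shiftC.
by rewrite !linearZ /= !shiftX e.
Qed.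

Hypothesis a0 : forall i, a 0 i != 0.

Let al_be i : al i * be i = 'X_i.
Proof.
rewrite /al /be; case: ifP => _.
  by rewrite mulrC mul_mpolyC scalerA mulVf ?scale1r.
by rewrite mul_mpolyC scalerA mulfV ?scale1r.
Qed.

Lemma act_eii i f : act_e i i f = act_h i f.
Proof.
exact: (odd_anticommE shift_comp shift0 ib0 ib1 bi0 bi1 al_loc be_loc al_be).
Qed.

Lemma M_actE X f : M_act X f =
  odd_action (fun i => act_ib i) (fun i => act_bi i) (sl_mx X) f.
Proof.
rewrite /M_act /odd_action -big_split; congr (_ + _ + _).
apply: eq_bigr => i _; rewrite [RHS](bigD1 i) //=; congr (_ + _).
by rewrite -act_eii.
Qed.

Lemma M_act_linearl f : linear (M_act ^~ f).
Proof. by move=> c X Y; rewrite !M_actE (odd_action_linearl _ _ f). Qed.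

Lemma M_act_linearr X : linear (M_act X).
Proof. by move=> c f g; rewrite !M_actE (odd_action_linearr _ _ (sl_mx X)). Qed.

Lemma M_act_bracket p q (X Y : sl F m) f :
  homogeneous p X -> homogeneous q Y ->
  M_act (sl_bracket X Y) f
    = M_act X (M_act Y f) - (-1) ^+ (p && q) *: M_act Y (M_act X f).
Proof.
rewrite !M_actE; apply: odd_action_bracket.
- exact: (odd_ib_ib ib0 ib1).
- exact: (odd_bi_bi bi0 bi1).
- exact: (odd_ib_bi_ib eq_shift shiftX shift_comp shift0 ib0 ib1 bi1
    al_loc be_loc al_be).
- exact: (odd_bi_ib_bi eq_shift shiftX shift_comp shift0 ib0 bi0 bi1
    al_loc be_loc al_be).
Qed.

Definition M_module : sl_module F m :=
  SLModule M_act_linearl M_act_linearr M_act_bracket.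

Let sum_delta_row (V : lmodType F) (G : 'I_m -> V) k :
  \sum_j (j == k)%:R *: G j = G k.
Proof.
rewrite (bigD1 k) //= eqxx scale1r big1 ?addr0 // => j /negPf ->.
by rewrite scale0r.
Qed.

Lemma M_act_h i (f : M_module) : sl_act (sl_h F i) f = act_h i f.
Proof.
rewrite /= /M_act /= h_mx_block block_mxKul block_mxKur block_mxKdl.
rewrite [X in _ + X]big1 ?addr0; last by move=> j _; rewrite mxE scale0r.
rewrite [X in _ + X]big1 ?addr0; last by move=> j _; rewrite mxE scale0r.
rewrite [X in _ + X]big1 ?addr0; last first.
  move=> j _; rewrite big1 // => k /negPf kj; rewrite mxE.
  by case: eqP => [<-|_]; rewrite ?kj scale0r.
by under eq_bigr do rewrite mxE andbb; rewrite sum_delta_row.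
Qed.

Lemma M_act_ib i (f : M_module) : sl_act (sl_ib F i) f = act_ib i f.
Proof.
rewrite /= /M_act /= ib_mx_block block_mxKul block_mxKur block_mxKdl.
rewrite [X in _ + X]big1 ?addr0; last by move=> j _; rewrite mxE scale0r.
rewrite [X in X + _ + _]big1 ?add0r; last by move=> j _; rewrite mxE scale0r.
rewrite [X in X + _]big1 ?add0r; last first.
  by move=> j _; rewrite big1 // => k _; rewrite mxE scale0r.
by under eq_bigr do rewrite mxE andbT; rewrite sum_delta_row.
Qed.

Lemma M_act_bi i (f : M_module) : sl_act (sl_bi F i) f = act_bi i f.
Proof.
rewrite /= /M_act /= bi_mx_block block_mxKul block_mxKur block_mxKdl.
rewrite [X in X + _ + _ + _]big1 ?add0r; last first.
  by move=> j _; rewrite mxE scale0r.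
rewrite [X in X + _ + _]big1 ?add0r; last first.
  by move=> j _; rewrite big1 // => k _; rewrite mxE scale0r.
rewrite [X in X + _]big1 ?add0r; last by move=> j _; rewrite mxE scale0r.
by under eq_bigr do rewrite mxE /=; rewrite sum_delta_row.
Qed.

End ExponentialModules.

(* Main.v *)
From HB Require Import structures.
Require Import Defs.
From mathcomp Require Import all_boot all_order all_algebra.
From mathcomp Require Import mpoly.
From mathcomp Require Import reals complex.

Import GRing.Theory.
Local Open Scope ring_scope.

(** An isomorphism commutes with the h_i, hence is C[h]-linear. The kernel of
    e_{i \bar 1} is the first summand C[h] and the kernel of e_{\bar 1 i} is the
    second one, so both summands are preserved and the isomorphism is the
    diagonal matrix of two units c, d of C[h], that is, of two nonzero scalars.
    Commutation with e_{i \bar 1} then amounts to equality of the monomials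
    c a_i h_i^[i in S1] and d b_i h_i^[i in S2]. *)

(** Compare the coefficients at [u]: if [v] differs from [u], the right-hand side contributes 0,
    against [x != 0]. *)
Lemma scale_mpolyX_inj (F : fieldType) (m : nat) (x y : F) (u v : 'X_{1..m}) :
  x != 0 -> x *: 'X_[u] = y *: 'X_[v] :> {mpoly F[m]} -> u = v /\ x = y.
Proof.
move=> x0 e; have := congr1 (mcoeff u) e.
rewrite !mcoeffZ !mcoeffX eqxx mulr1; have [->|_] := eqVneq v u.
  by rewrite mulr1.
by rewrite mulr0 => /eqP; rewrite (negPf x0).
Qed.

(** * Columns as pairs of polynomials, and the kernels of the odd generators *)

Section Columns.

Variables (F : fieldType) (m : nat).
Local Notation poly_h := {mpoly F[m]}.
Implicit Types (v w : hcol F m) (p q : poly_h).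

Definition hpair p q : hcol F m := \col_i (if i == 0 then p else q).

Lemma hpair0E p q : hpair p q 0 0 = p.
Proof. by rewrite mxE. Qed.

Lemma hpair1E p q : hpair p q 1 0 = q.
Proof. by rewrite mxE. Qed.

Lemma hcolP v w : v 0 0 = w 0 0 -> v 1 0 = w 1 0 -> v = w.
Proof.
move=> e0 e1; apply/matrixP => i j; rewrite [j]ord1.
case: i => [[|[|//]] Hi].
  by rewrite (_ : Ordinal Hi = 0) //; apply: val_inj.
by rewrite (_ : Ordinal Hi = 1) //; apply: val_inj.
Qed.

Lemma hpairK v : hpair (v 0 0) (v 1 0) = v.
Proof. by apply: hcolP; rewrite ?hpair0E ?hpair1E. Qed.

Lemma hpairD p q p' q' : hpair p q + hpair p' q' = hpair (p + p') (q + q').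
Proof. by apply: hcolP; rewrite hcol_addE ?hpair0E ?hpair1E. Qed.

Lemma hpair_scale c p q : c *: hpair p q = hpair (c *: p) (c *: q).
Proof. by apply: hcolP; rewrite [LHS]mxE ?hpair0E ?hpair1E. Qed.

Lemma hpair0 : hpair 0 0 = 0.
Proof. by apply: hcolP; rewrite hcol_0E ?hpair0E ?hpair1E. Qed.

(** The scaling attached to [hcol] is by [F]; this is the structure of module over the polynomial
    ring. *)
Definition hmul p v : hcol F m := hpair (p * v 0 0) (p * v 1 0).

Lemma hmul0 v : hmul 0 v = 0.
Proof. by rewrite /hmul !mul0r hpair0. Qed.

Lemma hmul1 v : hmul 1 v = v.
Proof. by rewrite /hmul !mul1r hpairK. Qed.

Lemma hmulM p q v : hmul (p * q) v = hmul p (hmul q v).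
Proof. by rewrite /hmul hpair0E hpair1E !mulrA. Qed.

Lemma hmulP c p q v : hmul (c *: p + q) v = c *: hmul p v + hmul q v.
Proof. by rewrite /hmul hpair_scale hpairD !mulrDl !scalerAl. Qed.

Lemma act_hE i v : act_h i v = hmul 'X_i v.
Proof. by apply: hcolP; rewrite ?hpair0E ?hpair1E [LHS]mxE. Qed.

Variables (a : 'rV[F]_m) (S : {set 'I_m}).

(** Writing both cases as a scalar times a monomial lets membership in [S] be read off the
    exponent. *)
Definition coef_ib i : poly_h :=
  a 0 i *: 'X_[if i \in S then U_(i)%MM else 0%MM].
Definition coef_bi i : poly_h :=
  (a 0 i)^-1 *: 'X_[if i \in S then 0%MM else U_(i)%MM].

Lemma act_ibE i v : act_ib a S i v = hpair (coef_ib i * Delta_inv_ i (v 1 0)) 0.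
Proof.
have E : E_ib a S i = coef_ib i *: delta_mx 0 1.
  by rewrite /E_ib /coef_ib; case: ifP => // _; rewrite mpolyX0 alg_mpolyC.
apply: hcolP; rewrite /act_ib E -scalemxAl mxE mxE big_ord_recl big_ord1 !mxE /=.
  rewrite mul0r add0r mul1r.
  by congr (_ * Delta_inv_ _ (v _ _)); apply: val_inj.
by rewrite !mul0r add0r mulr0.
Qed.

Lemma act_biE i v : act_bi a S i v = hpair 0 (coef_bi i * Delta_ i (v 0 0)).
Proof.
have E : E_bi a S i = coef_bi i *: delta_mx 1 0.
  by rewrite /E_bi /coef_bi; case: ifP => // _; rewrite mpolyX0 alg_mpolyC.
apply: hcolP; rewrite /act_bi E -scalemxAl mxE mxE big_ord_recl big_ord1 !mxE /=.
  by rewrite !mul0r add0r mulr0.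
by rewrite mul0r addr0 mul1r.
Qed.

Lemma Delta_0 i : Delta_ i (0 : poly_h) = 0.
Proof. by rewrite Delta_E linear0. Qed.

Lemma Delta_inv_0 i : Delta_inv_ i (0 : poly_h) = 0.
Proof. by rewrite Delta_inv_E linear0. Qed.

Hypothesis a0 : forall i, a 0 i != 0.

Lemma mpolyX_neq0 (u : 'X_{1..m}) : ('X_[u] : poly_h) != 0.
Proof.
apply/eqP => /(congr1 (mcoeff u)); rewrite mcoeffX mcoeff0 eqxx.
by apply/eqP; rewrite oner_eq0.
Qed.

(** The polynomial ring is a domain and [coef_ib] is nonzero, so the shifted component vanishes, and
    the shift is injective. *)
Lemma act_ib_eq0 i v : act_ib a S i v = 0 -> v 1 0 = 0.
Proof.
move/(congr1 (fun w : hcol F m => w 0 0)).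
rewrite act_ibE hpair0E hcol_0E => /eqP.
rewrite mulf_eq0 scaler_eq0 (negPf (a0 i)) (negPf (mpolyX_neq0 _)) /= => /eqP e.
by rewrite -[v 1 0](Delta_inv_K i) e Delta_0.
Qed.

Lemma act_bi_eq0 i v : act_bi a S i v = 0 -> v 0 0 = 0.
Proof.
move/(congr1 (fun w : hcol F m => w 1 0)).
rewrite act_biE hpair1E hcol_0E => /eqP.
rewrite mulf_eq0 scaler_eq0 invr_eq0 (negPf (a0 i)) (negPf (mpolyX_neq0 _)) /=.
by move=> /eqP e; rewrite -[v 0 0](Delta_K i) e Delta_inv_0.
Qed.

End Columns.

Arguments hpair {F m}.
Arguments hmul {F m}.

(** * Maps commuting with the generators: diagonal form and comparison of parameters *)

Section Intertwiners.

Variables (F : fieldType) (m : nat) (phi : {linear hcol F m -> hcol F m}).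
Local Notation poly_h := {mpoly F[m]}.
Implicit Types (v : hcol F m) (p q : poly_h).

Hypothesis phi_h : forall i v, phi (act_h i v) = act_h i (phi v).

Lemma commute_act_h_hmul p v : phi (hmul p v) = hmul p (phi v).
Proof.
elim/mpolyind: p v => [|c u p _ _ IHp] v; first by rewrite !hmul0 linear0.
rewrite !hmulP linearP /= IHp; congr (_ *: _ + _); rewrite mpolyXE_id.
(* Polynomials whose multiplication commutes with [phi] are closed under products and contain the
   variables, hence all monomials. *)
pose comm q := forall w, phi (hmul q w) = hmul q (phi w).
have comm1 : comm 1 by move=> w; rewrite !hmul1.
have commM q r : comm q -> comm r -> comm (q * r).
  by move=> cq cr w; rewrite !hmulM cq cr.
suff : comm (\prod_(i < m) 'X_i ^+ u i) by apply.
apply: (big_ind comm) => // i _; elim: (u i) => [//|k IHk].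
by rewrite exprS; apply: commM => // w; rewrite -!act_hE.
Qed.

Variables (a b : 'rV[F]_m) (S1 S2 : {set 'I_m}).
Hypotheses (a0 : forall i, a 0 i != 0) (b0 : forall i, b 0 i != 0).
Hypothesis phi_ib : forall i v, phi (act_ib a S1 i v) = act_ib b S2 i (phi v).
Hypothesis phi_bi : forall i v, phi (act_bi a S1 i v) = act_bi b S2 i (phi v).
Variable i0 : 'I_m.

Let c := phi (hpair 1 0) 0 0.
Let d := phi (hpair 0 1) 1 0.

(** The operator e_{i0 \bar 1} kills (1, 0), hence also its image, whose second component is
    therefore 0. The operator e_{\bar 1 i0} treats (0, 1) in the same way. *)
Lemma intertwiner_diag p q : phi (hpair p q) = hpair (p * c) (q * d).
Proof.
have -> : hpair p q = hmul p (hpair 1 0) + hmul q (hpair 0 1).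
  by rewrite /hmul hpairD !hpair0E !hpair1E !mulr0 !mulr1 addr0 add0r.
rewrite linearD /= !commute_act_h_hmul /hmul hpairD -/c -/d.
have -> : phi (hpair 1 0) 1 0 = 0.
  apply: (@act_ib_eq0 _ _ b S2 b0 i0).
  by rewrite -phi_ib act_ibE hpair1E Delta_inv_0 mulr0 hpair0 linear0.
have -> : phi (hpair 0 1) 0 0 = 0.
  apply: (@act_bi_eq0 _ _ b S2 b0 i0).
  by rewrite -phi_bi act_biE hpair0E Delta_0 mulr0 hpair0 linear0.
by rewrite !mulr0 addr0 add0r.
Qed.

Lemma intertwiner_parameters :
  bijective phi -> S1 = S2 /\ exists gamma, gamma != 0 /\ a = gamma *: b.
Proof.
case=> psi _ psiK.
(* By the diagonal form, [c] times the first component of a preimage of (1, 0) equals 1. *)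
have c_unit : c \in @mpoly_unit m F.
  apply: (mpoly_intro_unit (q := psi (hpair 1 0) 0 0)).
  have := psiK (hpair 1 0); rewrite -{1}[psi _]hpairK intertwiner_diag.
  by move=> /(congr1 (fun w : hcol F m => w 0 0)); rewrite !hpair0E.
have d_unit : d \in @mpoly_unit m F.
  apply: (mpoly_intro_unit (q := psi (hpair 0 1) 1 0)).
  have := psiK (hpair 0 1); rewrite -{1}[psi _]hpairK intertwiner_diag.
  by move=> /(congr1 (fun w : hcol F m => w 1 0)); rewrite !hpair1E.
(* A unit of the polynomial ring equals its constant coefficient, which is nonzero. *)
case/andP: c_unit; case/andP: d_unit.
set d0 := d@_0; set c0 := c@_0; rewrite !unitfE => /eqP dE d0n /eqP cE c0n.
have coefE i : (if i \in S1 then U_(i)%MM else 0%MM)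
    = (if i \in S2 then U_(i)%MM else 0%MM) /\ c0 * a 0 i = d0 * b 0 i.
  apply: (@scale_mpolyX_inj F m); first by rewrite mulf_neq0.
  (* Evaluating at (0, 1) isolates the coefficients of e_{i \bar 1}, since shifts fix the constants
     1 and [d]. *)
  have := phi_ib i (hpair 0 1); rewrite intertwiner_diag !act_ibE.
  rewrite intertwiner_diag !hpair1E !mul1r.
  move=> /(congr1 (fun w : hcol F m => w 0 0)); rewrite !hpair0E.
  rewrite dE cE !Delta_inv_E (rmorph1 (shift _)) shiftC mulr1.
  by rewrite /coef_ib ![_ * _%:MP]mulrC !mul_mpolyC !scalerA.
split.
  apply/setP => i; case: (coefE i) => + _.
  (* If [i] lay in only one of the two sets, the exponents would give U_(i) = 0. *)
  have := mnm1_eq0 i.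
  by case: (i \in S1); case: (i \in S2) => // + e; rewrite ?e -?e eqxx.
(* This ratio solves c0 a_i = d0 b_i for all i at once. *)
exists (c0^-1 * d0); split; first by rewrite mulf_neq0 ?invr_eq0.
apply/rowP => i; rewrite mxE -mulrA -(proj2 (coefE i)).
by rewrite mulrA mulVf ?mul1r.
Qed.

End Intertwiners.

(** * The diagonal isomorphism between proportional parameters *)

Section Rescaling.

Variables (F : fieldType) (m : nat).

(** For a = g b, the condition c a_i = d b_i is met by c = 1 and d = g. *)
Definition rescale (g : F) (v : hcol F m) : hcol F m :=
  hpair (v 0 0) (g *: v 1 0).

Lemma rescale_is_linear g : linear (rescale g).
Proof.
move=> c v w; rewrite /rescale hpair_scale hpairD !hcol_linE.
by rewrite scalerDr !scalerA mulrC.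
Qed.

HB.instance Definition _ g := GRing.isLinear.Build F (hcol F m) (hcol F m) _
  (rescale g) (rescale_is_linear g).

Lemma rescaleK g : g != 0 -> cancel (rescale g) (rescale g^-1).
Proof.
move=> g0 v; rewrite /rescale hpair0E hpair1E scalerA mulVf // scale1r.
exact: hpairK.
Qed.

Lemma rescale_bij g : g != 0 -> bijective (rescale g).
Proof.
move=> g0; exists (rescale g^-1); first exact: rescaleK.
by rewrite -{2}[g]invrK; apply: rescaleK; rewrite invr_eq0.
Qed.

Lemma rescale_h g i v : rescale g (act_h i v) = act_h i (rescale g v).
Proof.
by rewrite !act_hE /rescale /hmul !hpair0E !hpair1E -scalerAr.
Qed.

Variables (S : {set 'I_m}) (b : 'rV[F]_m) (g : F).
Hypothesis g0 : g != 0.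

Lemma rescale_ib i v :
  rescale g (act_ib (g *: b) S i v) = act_ib b S i (rescale g v).
Proof.
rewrite !act_ibE /rescale !hpair0E !hpair1E scaler0 /coef_ib mxE.
by rewrite !Delta_inv_E linearZ /= -scalerA -scalerAl -scalerAr.
Qed.

(** The factor [g] on the second component cancels the inverse of [g] in (g b_i)^-1. *)
Lemma rescale_bi i v :
  rescale g (act_bi (g *: b) S i v) = act_bi b S i (rescale g v).
Proof.
rewrite !act_biE /rescale !hpair0E !hpair1E /coef_bi mxE invfM.
by rewrite scalerAl !scalerA mulrA mulfV // mul1r.
Qed.

(** Every element acts by linear combinations of [act_h], [act_ib], [act_bi] and the composites in
    [act_e], so commutation with the first three is enough. *)
Lemma rescale_act (a0 : forall i, (g *: b) 0 i != 0) (b0 : forall i, b 0 i != 0)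
    X v :
  rescale g (sl_act (s := M_module S a0) X v)
  = sl_act (s := M_module S b0) X (rescale g v).
Proof.
rewrite /= /M_act !linearD !linear_sum /=; congr (_ + _ + _ + _);
  apply: eq_bigr => i _.
- by rewrite linearZ /= rescale_h.
- rewrite linear_sum; apply: eq_bigr => j _.
  by rewrite linearZ /= /act_e linearD /= !(rescale_ib, rescale_bi).
- by rewrite linearZ /= rescale_ib.
- by rewrite linearZ /= rescale_bi.
Qed.

End Rescaling.

Theorem proposition4p9 (R : realType) (m : nat) (hm : (2 <= m)%N)
    (S1 S2 : {set 'I_m}) (a b : 'rV[R[i]]_m)
    (ha : forall i : 'I_m, a 0 i != 0) (hb : forall i : 'I_m, b 0 i != 0) :
  sl_module_iso (M_module S1 ha) (M_module S2 hb) <->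
  S1 = S2 /\ exists gamma : R[i], gamma != 0 /\ a = gamma *: b.
Proof.
split=> [[f [f_bij f_act]]|[<- [g [g0 ag]]]].
  apply: (@intertwiner_parameters _ _ f _ a b S1 S2 ha hb) => //.
  - by move=> i v; rewrite -(@M_act_h _ _ a S1 ha) f_act M_act_h.
  - by move=> i v; rewrite -(@M_act_ib _ _ a S1 ha) f_act M_act_ib.
  - by move=> i v; rewrite -(@M_act_bi _ _ a S1 ha) f_act M_act_bi.
  (* The bound on [m] supplies the index 0 as [i0], whose odd generators detect the two summands. *)
  - exact: Ordinal (ltnW hm).
subst a; exists (rescale _ _ g : {linear M_module S1 ha -> M_module S1 hb}).
by split; [exact: rescale_bij | exact: rescale_act].
Qed.
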